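(* Consider RMAB-G instances with given $N$, $K$, $\mathcal{S}$, $\mathcal{A}=\{0,1\}$, rewards $R_i$, $R_{\mathrm{glob}}$ and discount $\gamma$. Let $R(\mathbf{s},\mathbf{a})=R_{\mathrm{glob}}(\mathbf{s},\mathbf{a})+\sum_{i=1}^N R_i(s_i,a_i)$, and let $u_i$ be the Shapley value defined in the context. Let $$\hat{\mathbf{a}}(\mathbf{s})=\operatorname*{arg\,max}_{\mathbf{a}\in\{0,1\}^N,\ \|\mathbf{a}\|_1\le K}\ \sum_{i=1}^N\big(R_i(s_i,a_i)+u_i(s_i)a_i\big).$$ For a set of transitions $\mathcal{P}=\{P_1,\dots,P_N\}$ and an initial state $\mathbf{s}^{(0)}$, let $$\mathrm{OPT}=\max_\pi\mathbb{E}_{(\mathbf{s},\mathbf{a})\sim(P,\pi)}\Big[\sum_{t=0}^\infty\gamma^tR(\mathbf{s}^{(t)},\mathbf{a}^{(t)})\,\Big|\,\mathbf{s}^{(0)}\Big],\qquad \mathrm{ALG}=\mathbb{E}_{(\mathbf{s},\mathbf{a})\sim(P,\pi_{\mathrm{shapley}})}\Big[\sum_{t=0}^\infty\gamma^tR(\mathbf{s}^{(t)},\mathbf{a}^{(t)})\,\Big|\,\mathbf{s}^{(0)}\Big],$$ where $\pi_{\mathrm{shapley}}$ is the Shapley-Whittle policy. Define $$\theta_{\mathrm{shapley}}=\min_{\mathbf{s}\in\mathcal{S}^N}\frac{R(\mathbf{s},\hat{\mathbf{a}}(\mathbf{s}))}{\max_{\mathbf{a}\in\{0,1\}^N,\ \|\mathbf{a}\|_1\le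 K}R(\mathbf{s},\mathbf{a})}.$$ Then there exist transitions $\mathcal{P}$ and an initial state $\mathbf{s}^{(0)}$ such that $\mathrm{ALG}\le\theta_{\mathrm{shapley}}\,\mathrm{OPT}$.
   Context: **RMAB-G.** There are $N$ arms with states in a finite set $\mathcal{S}$, actions in $\mathcal{A}=\{0,1\}$ (1 = pull), per-arm rewards $R_i:\mathcal{S}\times\mathcal{A}\to\mathbb{R}$, a global reward $R_{\mathrm{glob}}:\mathcal{S}^N\times\mathcal{A}^N\to\mathbb{R}$ that is, for each fixed $\mathbf{s}$, a monotone submodular set function of $\{i:a_i=1\}$, transition functions $P_i:\mathcal{S}\times\mathcal{A}\times\mathcal{S}\to[0,1]$ (arms transition independently given states and actions), $\gamma\in[0,1)$, and a budget $K$: every policy $\pi:\mathcal{S}^N\to\mathcal{A}^N$ must satisfy $\sum_i a_i^{(t)}\le K$ for all $t$. **Shapley value.** With $\mathbf{e}_i$ the $i$-th standard basis vector and $\lor$ the elementwise maximum, $$u_i(s_i)=\min_{\mathbf{s}':s_i'=s_i}\ \sum_{\mathbf{a}\in\{0,1\}^N,\ a_i=0,\ \|\mathbf{a}\|_1\le K-1}\frac{\|\mathbf{a}\|_1!\,(N-\|\mathbf{a}\|_1-1)!}{\frac{N!}{(N-K)!}}\big(R_{\mathrm{glob}}(\mathbf{s}',\mathbf{a}\lor\mathbf{e}_i)-R_{\mathrm{glob}}(\mathbf{s}',\mathbf{a})\big).$$ **Shapley-Whittle policy.** For $w\in\mathbb{R}$ let $$Q^S_{i,w}(s_i,a_i,u_i)=-a_iw+R_i(s_i,a_i)+a_iu_i(s_i)+\gamma\sum_{s_i'}P_i(s_i,a_i,s_i')V_{i,w}(s_i'),\qquad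 V_{i,w}(s_i')=\max_{a_i'}Q^S_{i,w}(s_i',a_i',u_i).$$ The Shapley-Whittle index is $w_i^S(s_i,u_i)=\min\{w: Q^S_{i,w}(s_i,0,u_i)>Q^S_{i,w}(s_i,1,u_i)\}$ (minimum understood as infimum). The Shapley-Whittle policy pulls the $K$ arms with the highest indices in the current state.
   Formalization: The Shapley-Whittle policy is taken to pull at most K arms of highest index and never an arm of negative index (pulling exactly K makes the claim false); ties in the policy and in â are resolved by one common rule; a ratio with zero denominator counts as 0. *)

(* Defs.v *)
From HB Require Import structures.
From mathcomp Require Import all_boot all_order all_algebra.
From mathcomp Require Import all_classical all_reals all_analysis.

Set Implicit Arguments.
Unset Strict Implicit.
Unset Printing Implicit Defensive.

Import Order.TTheory GRing.Theory Num.Theory.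
Import numFieldNormedType.Exports.

Local Open Scope classical_set_scope.
Local Open Scope ring_scope.

Definition jstate (S : finType) (N : nat) := {ffun 'I_N -> S}.
Definition action (N : nat) := {ffun 'I_N -> bool}.

Section SetFunctions.
Context (R : realType) (T : finType).
Implicit Type f : {set T} -> R.

Definition monotone_setfun f :=
  forall A B : {set T}, A \subset B -> f A <= f B.

Definition submodular f :=
  forall A B : {set T}, f (A :|: B)%SET + f (A :&: B)%SET <= f A + f B.

End SetFunctions.

Section Actions.
Context (N : nat).
Implicit Types a b : action N.

Definition pulling (A : {set 'I_N}) : action N := [ffun i => i \in A].

Definition norm1 a : nat := \sum_(i < N) a i.

Definition basis_action (i : 'I_N) : action N := [ffun j => j == i].

Definition action_max a b : action N := [ffun j => a j || b j].

End Actions.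

(* An instance without its transitions: [rew] is the family R_i, [Rglob] the
   global reward, [K] the budget, [gamma] the discount. *)
Section Instance.
Context (R : realType) (S : finType) (N K : nat).
Context (rew : 'I_N -> S -> bool -> R).
Context (Rglob : jstate S N -> action N -> R).
Context (gamma : R).

Definition total_reward (s : jstate S N) (a : action N) : R :=
  Rglob s a + \sum_(i < N) rew i (s i) (a i).

(* [norm1 a < K] stands for ||a||_1 <= K - 1, avoiding truncated K - 1. *)
Definition shapley_sum (i : 'I_N) (s : jstate S N) : R :=
  \sum_(a : action N | ~~ a i && (norm1 a < K)%N)
    ((norm1 a)`!%:R * (N - norm1 a - 1)`!%:R / (N`!%:R / (N - K)`!%:R))
    * (Rglob s (action_max a (basis_action i)) - Rglob s a).

(* Here and in [theta_shapley] and [max_reward], [inf] and [sup] range over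
   finite nonempty sets of reals, so they are a minimum and a maximum. *)
Definition shapley (i : 'I_N) (x : S) : R :=
  inf [set shapley_sum i s | s in [set s : jstate S N | s i = x]].

Definition shapley_objective (s : jstate S N) (a : action N) : R :=
  \sum_(i < N) (rew i (s i) (a i) + shapley i (s i) * (a i)%:R).

Definition shapley_argmax (s : jstate S N) : {set action N} :=
  [set a | (norm1 a <= K)%N &&
     [forall b : action N,
        (norm1 b <= K)%N ==> (shapley_objective s b <= shapley_objective s a)]
  ]%SET.

Definition max_reward (s : jstate S N) : R :=
  sup [set total_reward s a | a in [set a : action N | (norm1 a <= K)%N]].

(* Neither an arg max nor "the K highest indices" determines an action when
   there are ties; one and the same rule resolves both. *)
Definition tie_breaking (tb : jstate S N -> {set action N} -> action N) :=
  forall s (A : {set action N}) a, a \in A -> tb s A \in A.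

Definition theta_shapley (tb : jstate S N -> {set action N} -> action N) : R :=
  inf [set total_reward s (tb s (shapley_argmax s)) / max_reward s
      | s in [set: jstate S N]].

Section Transitions.
Context (P : 'I_N -> S -> bool -> S -> R).

Definition is_transition :=
  forall i x a, (forall y, 0 <= P i x a y) /\ \sum_(y : S) P i x a y = 1.

Definition joint_transition (s : jstate S N) (a : action N) (s' : jstate S N) :
    R :=
  \prod_(i < N) P i (s i) (a i) (s' i).

Definition Qshapley (i : 'I_N) (w : R) (V : S -> R) (x : S) (a : bool) : R :=
  - (a%:R * w) + rew i x a + a%:R * shapley i x
  + gamma * \sum_(y : S) P i x a y * V y.

(* For 0 <= gamma < 1 this fixed-point equation has exactly one solution. *)
Definition is_value_function (i : 'I_N) (w : R) (V : S -> R) :=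
  forall y, V y = Num.max (Qshapley i w V y false) (Qshapley i w V y true).

Definition shapley_whittle_index (i : 'I_N) (x : S) : R :=
  inf [set w | exists2 V, is_value_function i w V &
                 Qshapley i w V x true < Qshapley i w V x false].

(* The actions that pull the K arms of highest index [w], where, the budget
   being an upper bound, an arm of negative index is left passive even if fewer
   than K arms are then pulled, and an arm of index 0 may go either way. *)
Definition top_index_actions (w : 'I_N -> R) : {set action N} :=
  [set a : action N | [&& (norm1 a <= K)%N,
     [forall i, forall j, a i && ~~ a j ==> (w j <= w i)],
     [forall i, a i ==> (0 <= w i)] &
     (norm1 a < K)%N ==> [forall j, ~~ a j ==> (w j <= 0)]]]%SET.

Definition shapley_whittle (tb : jstate S N -> {set action N} -> action N)
    (s : jstate S N) : action N :=
  tb s (top_index_actions (fun i => shapley_whittle_index i (s i))).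

Definition feasible (pi : jstate S N -> action N) :=
  forall s, (norm1 (pi s) <= K)%N.

(* [X] is a version of the state process under [P] and [pi] from [s0], given
   by its finite-dimensional laws. *)
Definition is_trajectory (s0 : jstate S N) (pi : jstate S N -> action N)
    (d : measure_display) (Omega : measurableType d) (mu : probability Omega R)
    (X : nat -> Omega -> jstate S N) :=
  (forall t s, measurable (X t @^-1` [set s])) /\
  (forall n (h : nat -> jstate S N),
     mu [set o | forall t, (t <= n)%N -> X t o = h t] =
     ((h 0%N == s0)%:R *
      \prod_(t < n) joint_transition (h t) (pi (h t)) (h t.+1))%:E).

(* The number [v] is the expected discounted return of [pi] from [s0]; it
   depends only on the law of the process, not on the space carrying it. *)
Definition expected_return (s0 : jstate S N) (pi : jstate S N -> action N)
    (v : R) :=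
  exists (d : measure_display) (Omega : measurableType d)
    (mu : probability Omega R) (X : nat -> Omega -> jstate S N),
    is_trajectory s0 pi mu X /\
    ('E_mu[fun o => limn (series (fun t =>
        gamma ^+ t * total_reward (X t o) (pi (X t o))))%R] = v%:E)%E.

Definition optimal_return (s0 : jstate S N) (v : R) :=
  (exists2 pi, feasible pi & expected_return s0 pi v) /\
  (forall pi v', feasible pi -> expected_return s0 pi v' -> v' <= v).

End Transitions.
End Instance.

(* Main.v *)
(* Let no arm ever change state.  The index of an arm in state [x] is then its
   one-step gain [R_i(x,1) - R_i(x,0) + u_i(x)], so the Shapley-Whittle policy
   maximizes the objective of [hat a]: the same rule [tb] breaks the same ties.
   Every stationary policy earns a constant reward, and starting from a state
   minimizing the ratio that defines [theta_shapley] gives [ALG = theta * OPT],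
   or [ALG <= 0 = theta * OPT] if the best reward there is [0]. *)
Require Import Defs.
From HB Require Import structures.
From mathcomp Require Import all_boot all_order all_algebra.
From mathcomp Require Import all_classical all_reals all_analysis.
From mathcomp Require Import ring lra zify.

Import Order.TTheory GRing.Theory Num.Theory.
Import numFieldNormedType.Exports.

Local Open Scope classical_set_scope.
Local Open Scope ring_scope.

(** * Top-index actions as maximizers of a linear form under the budget *)

Definition update_action {N : nat} (a : action N) (i : 'I_N) (v : bool) :
  action N := [ffun k => if k == i then v else a k].

Lemma sum_update_action {R : pzRingType} {N : nat} (w : 'I_N -> R)
    (a : action N) (i : 'I_N) (v : bool) :
  \sum_k w k * (update_action a i v k)%:R =
  \sum_k w k * (a k)%:R + w i * (v%:R - (a i)%:R).
Proof.
rewrite (bigD1 i) //= [in RHS](bigD1 i) //= ffunE eqxx mulrBr.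
rewrite [RHS]addrAC addrCA subrr addr0 addrC [RHS]addrC; congr (_ + _).
by apply: eq_bigr => k /negPf ki; rewrite ffunE ki.
Qed.

Lemma natr_norm1 {R : pzRingType} {N : nat} (a : action N) :
  (norm1 a)%:R = \sum_i 1 * (a i)%:R :> R.
Proof. by rewrite natr_sum; apply: eq_bigr => i _; rewrite mul1r. Qed.

(** The additive form avoids truncated subtraction; it is the case of unit weights in
    [sum_update_action], read in [int]. *)
Lemma norm1_update {N : nat} (a : action N) (i : 'I_N) (v : bool) :
  (norm1 (update_action a i v) + a i = norm1 a + v)%N.
Proof.
apply/eqP; rewrite -(eqr_nat int) !natrD !natr_norm1 sum_update_action.
by rewrite mul1r addrA subrK.
Qed.

(* With the threshold [tau] below, the objective gap of a competitor [b] is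
   [\sum_i (w i - tau) (b_i - a_i) + tau (norm1 b - norm1 a)], and every term
   is nonpositive.  The converse is by exchanging, adding or dropping arms. *)
Lemma top_index_actionsE {R : realType} {N : nat} (K : nat) (w : 'I_N -> R) :
  top_index_actions K w = [set a : action N | (norm1 a <= K)%N &&
    [forall b : action N, (norm1 b <= K)%N ==>
      (\sum_i w i * (b i)%:R <= \sum_i w i * (a i)%:R)]]%SET.
Proof.
apply/setP => a; rewrite !inE; case: (leqP (norm1 a) K) => //= aK.
apply/and3P/forallP => [[/'forall_forallP swap /forallP pos spare] b|opt].
- apply/implyP => bK.
  pose tau := \big[Num.max/0]_(j | ~~ a j) w j.
  have tau0 : 0 <= tau by exact: bigmax_ge_id.
  have w_on i : a i -> tau <= w i.
    move=> ai; apply: bigmax_le => [|j aj]; first exact: (implyP (pos i)).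
    by apply: (implyP (swap i j)); rewrite ai.
  have w_off j : ~~ a j -> w j <= tau by move=> aj; exact: le_bigmax_cond.
  (* If [a] exhausts the budget, [b] pulls no more arms than [a] and [tau] is nonnegative. Otherwise
     [spare] bounds every passive index by 0, so [tau] is 0. *)
  have gap : tau * (norm1 b)%:R <= tau * (norm1 a)%:R.
    move: aK; rewrite leq_eqVlt => /predU1P[aK|ltK].
      by rewrite ler_wpM2l// ler_nat aK.
    have -> : tau = 0; last by rewrite !mul0r.
    apply/le_anti; rewrite tau0 andbT; apply: bigmax_le => // j aj.
    by have /forallP/(_ j)/implyP := implyP spare ltK; apply.
  have : \sum_i (w i - tau) * (b i)%:R <= \sum_i (w i - tau) * (a i)%:R.
    apply: ler_sum => i _; have := w_on i; have := w_off i.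
    by case: (a i) (b i) => -[] /= off on; rewrite ?mulr1 ?mulr0 //
      ?subr_ge0 ?subr_le0; [exact: on|exact: off].
  have gapE (c : action N) : \sum_i (w i - tau) * (c i)%:R =
      \sum_i w i * (c i)%:R - tau * (norm1 c)%:R :> R.
    rewrite natr_norm1 mulr_sumr -sumrB; apply: eq_bigr => i _.
    by rewrite mul1r mulrBl.
  rewrite !gapE; lra.
- split.
  + apply/'forall_forallP => i j; apply/implyP => /andP[ai aj].
    have := norm1_update a i false; rewrite ai => card1.
    have ij : j != i by apply: contraNneq aj => ->.
    have := norm1_update (update_action a i false) j true.
    rewrite ffunE (negPf ij) (negPf aj) => card2.
    have /implyP/(_ _) := opt (update_action (update_action a i false) j true).
    rewrite !sum_update_action ffunE (negPf ij) (negPf aj) ai /=.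
    by move=> H; have := H ltac:(lia); lra.
  + apply/forallP => i; apply/implyP => ai.
    have := norm1_update a i false; rewrite ai => card1.
    have /implyP/(_ _) := opt (update_action a i false).
    by rewrite sum_update_action ai /= => H; have := H ltac:(lia); lra.
  + apply/implyP => ltK; apply/forallP => j; apply/implyP => aj.
    have := norm1_update a j true; rewrite (negPf aj) => card1.
    have /implyP/(_ _) := opt (update_action a j true).
    by rewrite sum_update_action (negPf aj) /= => H; have := H ltac:(lia); lra.
Qed.

(** * Arms that never change state, and their index *)

Definition stay {R : pzSemiRingType} {S : finType} {N : nat}
  (i : 'I_N) (x : S) (a : bool) (y : S) : R := (y == x)%:R.

Lemma sum_indicator_eq {R : pzSemiRingType} {S : finType} (V : S -> R) (x : S) :
  \sum_y (y == x)%:R * V y = V x.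
Proof.
rewrite (bigD1 x) //= eqxx mul1r big1 ?addr0 // => y /negPf ->.
by rewrite mul0r.
Qed.

Lemma is_transition_stay {R : realType} {S : finType} {N : nat} :
  is_transition (@stay R S N).
Proof.
move=> i x a; split=> [y|]; first exact: ler0n.
rewrite -[RHS](sum_indicator_eq (fun=> 1) x).
by apply: eq_bigr => y _; rewrite mulr1.
Qed.

Lemma joint_transition_stay {R : realType} {S : finType} {N : nat}
    (s : jstate S N) (a : action N) (s' : jstate S N) :
  joint_transition (@stay R S N) s a s' = (s' == s)%:R.
Proof.
rewrite /joint_transition /stay; have [-> | ss'] := eqVneq s' s.
  by rewrite big1 // => i _; rewrite eqxx.
have /existsP[i /negPf si] : [exists i, s' i != s i].
  rewrite -negb_forall; apply: contraNN ss' => /forallP ss'.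
  by apply/eqP/ffunP => i; apply/eqP.
by rewrite (bigD1 i) //= si mul0r.
Qed.

(** Both actions lead to the same continuation value [gamma * V x], which cancels. The charges [w]
    that make passivity strictly better thus form the open half-line above the one-step gain. *)
Lemma shapley_whittle_index_stay {R : realType} {S : finType} {N : nat}
    (K : nat) (rew : 'I_N -> S -> bool -> R)
    (Rglob : jstate S N -> action N -> R)
    (gamma : R) (i : 'I_N) (x : S) : gamma < 1 ->
  shapley_whittle_index K rew Rglob gamma stay i x =
  rew i x true - rew i x false + shapley K Rglob i x.
Proof.
move=> gamma1; rewrite -[RHS](@inf_itv _ +oo%O false) //.
congr inf; apply/seteqP; split=> w /=.
  case=> V _; rewrite /Qshapley in_itv /= andbT; lra.
rewrite in_itv /= andbT => lt_w.
pose r y (a : bool) := - (a%:R * w) + rew i y a + a%:R * shapley K Rglob i y.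
have QE V y a : Qshapley K rew Rglob gamma stay i w V y a = r y a + gamma * V y.
  by rewrite /Qshapley sum_indicator_eq.
(* The solution of [V y = max (r y false) (r y true) + gamma * V y]. *)
exists (fun y => Num.max (r y false) (r y true) / (1 - gamma)).
  move=> y; rewrite !QE -addr_maxl; field; lra.
rewrite !QE ltrD2r /r /=; lra.
Qed.

(** * Discounted returns when no arm changes state *)

Lemma measurable_finfun_comp {d : measure_display} {Omega : measurableType d}
    {R : realType} {J : finType} (g : J -> R) (Y : Omega -> J) :
  (forall j, measurable (Y @^-1` [set j])) ->
  measurable_fun [set: Omega] (g \o Y).
Proof.
move=> mY _ B _; rewrite setTI.
have -> : (g \o Y) @^-1` B = \bigcup_(j in g @^-1` B) (Y @^-1` [set j]).
  apply/seteqP; split=> [w gB|w [j gB Yw]] /=.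
    by exists (Y w).
  by rewrite Yw.
by apply: fin_bigcup_measurable => [|j _]; [exact: finite_finset|exact: mY].
Qed.

(** A function on a finite type is bounded, so a geometric series dominates along every path [x]. *)
Lemma is_cvg_discounted_series {R : realType} {J : finType} (gamma : R)
    (g : J -> R) (x : nat -> J) : 0 <= gamma < 1 ->
  cvgn (series (fun t => gamma ^+ t * g (x t))).
Proof.
move=> /andP[gamma0 gamma1].
pose M := \big[Num.max/0]_j `|g j|.
have M0 : 0 <= M by exact: bigmax_ge_id.
apply: normed_cvg.
apply: (@series_le_cvg _ _ (geometric M gamma)) => [t|t|t|].
- exact: normr_ge0.
- by rewrite mulr_ge0 ?exprn_ge0.
- rewrite /= normrM normrX ger0_norm // [leRHS]mulrC ler_wpM2l ?exprn_ge0 //.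
  exact: le_bigmax.
- by apply: is_cvg_geometric_series; rewrite ger0_norm.
Qed.

Lemma discounted_series_cst {R : realType} (gamma c : R) : 0 <= gamma < 1 ->
  limn (series (fun t => gamma ^+ t * c)) = c / (1 - gamma).
Proof.
move=> /andP[gamma0 gamma1]; apply: cvg_lim => //.
have -> : (fun t => gamma ^+ t * c) = geometric c gamma.
  by apply/funext => t; rewrite mulrC.
by apply: cvg_geometric_series; rewrite ger0_norm.
Qed.

(** The process is deterministic, so a one-point space with its Dirac measure carries it. *)
Lemma expected_return_stay {R : realType} {S : finType} {N : nat}
    (rew : 'I_N -> S -> bool -> R) (Rglob : jstate S N -> action N -> R)
    (gamma : R) (s0 : jstate S N) (pi : jstate S N -> action N) :
  0 <= gamma < 1 ->
  expected_return rew Rglob gamma stay s0 pi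
    (total_reward rew Rglob s0 (pi s0) / (1 - gamma)).
Proof.
move=> gammaP.
exists default_measure_display, unit, (@dirac _ unit tt R), (fun _ _ => s0).
split; last by rewrite discounted_series_cst // expectation_cst.
split=> // n h; apply: etrans (diracE _ _ _) _; congr (_%:E).
under eq_bigr do rewrite joint_transition_stay.
(* Both sides are 1 if [h] equals [s0] up to time [n], and 0 otherwise: either [h] starts elsewhere,
   or some step before [n] moves and its transition factor vanishes. *)
have [h_s0|h_s0] := pselect (forall t, (t <= n)%N -> s0 = h t).
  rewrite mem_set // -(h_s0 0%N) // eqxx mul1r big1 // => t _.
  by rewrite -!h_s0 ?eqxx //; exact: ltnW.
rewrite memNset //; have [h0|_] := eqVneq (h 0%N) s0; last by rewrite mul0r.
have [t ht] : exists t : 'I_n, h t.+1 != h t.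
  apply/existsP; rewrite -negb_forall; apply/negP => /forallP step.
  apply: h_s0; elim=> [|t IH] tn; first by rewrite h0.
  by have /eqP -> := step (Ordinal tn); apply: IH; exact: ltnW.
by rewrite (bigD1 t) //= (negPf ht) mul0r mulr0.
Qed.

(** Optimality compares values realized on arbitrary probability spaces. On each of them the process
    almost surely remains at [s0], so the return is almost surely constant. *)
Lemma expected_return_stay_unique {R : realType} {S : finType} {N : nat}
    (rew : 'I_N -> S -> bool -> R) (Rglob : jstate S N -> action N -> R)
    (gamma : R) (s0 : jstate S N) (pi : jstate S N -> action N) (v : R) :
  0 <= gamma < 1 -> expected_return rew Rglob gamma stay s0 pi v ->
  v = total_reward rew Rglob s0 (pi s0) / (1 - gamma).
Proof.
move=> gammaP [d [T [mu [X [[mX lawX] meanX]]]]].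
pose g s := total_reward rew Rglob s (pi s).
(* At each [t] the event contains the path constantly [s0] up to [t], which has probability 1 by
   [lawX]; countably many null sets are then combined. *)
have aeX : \forall o \ae mu, forall t, X t o = s0.
  apply: ae_foralln => t.
  have mA : measurable (X t @^-1` [set s0]) by exact: mX.
  exists (~` (X t @^-1` [set s0])); split=> //; first exact: measurableC.
  apply: etrans (probability_setC mu mA) _.
  suff -> : mu (X t @^-1` [set s0]) = 1%E by rewrite subee.
  apply/le_anti; rewrite probability_le1 //=.
  have path1 : mu [set o | forall k, (k <= t)%N -> X k o = s0] = 1%E.
    rewrite lawX eqxx mul1r big1 // => k _.
    by rewrite joint_transition_stay eqxx.
  rewrite -path1; apply: le_measure; rewrite ?inE //.
    have -> : [set o | forall k, (k <= t)%N -> X k o = s0] =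
        \bigcap_(k in [set k | (k <= t)%N]) (X k @^-1` [set s0]) by [].
    by apply: bigcap_measurable => [|k _]; [exists t; exact: leqnn|exact: mX].
  by move=> o; apply.
move: meanX; rewrite unlock => meanX.
apply: EFin_inj; rewrite -meanX.
rewrite (@ae_eq_integral _ _ _ mu setT (cst (g s0 / (1 - gamma))%:E)) //.
- by have := expectation_cst mu (g s0 / (1 - gamma)); rewrite unlock.
(* The random return is measurable as a pointwise limit of measurable partial sums, convergent at
   every outcome. *)
- apply/measurable_realfun.measurable_EFinP.
  apply: (@measurable_realfun.measurable_fun_cvg _ _ _ _
    (fun n o => series (fun t => gamma ^+ t * g (X t o)) n)) => [n|w _].
    apply: measurable_sum => t; apply: measurable_realfun.measurable_funM => //.
    exact: measurable_finfun_comp (g) (X t) (mX t).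
  exact: is_cvg_discounted_series.
- apply: filterS aeX => o Xo _ /=; congr (_%:E).
  by under eq_fun do rewrite Xo; rewrite discounted_series_cst.
Qed.

(** * Attained extrema and the comparison of the two policies *)

Lemma inf_attained {R : realType} {J : Type} (A : set J) (f : J -> R) (j : J) :
  A j -> (forall k, A k -> f j <= f k) -> inf [set f k | k in A] = f j.
Proof.
move=> Aj minf; apply/le_anti/andP; split.
  by apply: ge_inf; [exists (f j) => _ [k Ak <-]; exact: minf|exists j].
by apply: lb_le_inf => [|_ [k Ak <-]]; [exists (f j); exists j|exact: minf].
Qed.

Lemma sup_attained {R : realType} {J : Type} (A : set J) (f : J -> R) (j : J) :
  A j -> (forall k, A k -> f k <= f j) -> sup [set f k | k in A] = f j.
Proof.
move=> Aj maxf; apply/le_anti/andP; split.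
  by apply: ge_sup => [|_ [k Ak <-]]; [exists (f j); exists j|exact: maxf].
by apply: ub_le_sup; [exists (f j) => _ [k Ak <-]; exact: maxf|exists j].
Qed.

Definition idle {N : nat} : action N := [ffun=> false].

Lemma norm1_idle {N : nat} : norm1 (@idle N) = 0%N.
Proof. by rewrite /norm1 big1 // => i _; rewrite ffunE. Qed.

(** The objective is the linear form in the one-step gains plus a term independent of the action.
    Equality of the whole sets matters, since [tb] takes the set as argument. *)
Lemma shapley_argmaxE {R : realType} {S : finType} {N : nat} (K : nat)
    (rew : 'I_N -> S -> bool -> R) (Rglob : jstate S N -> action N -> R)
    (s : jstate S N) :
  shapley_argmax K rew Rglob s = top_index_actions K (fun i =>
    rew i (s i) true - rew i (s i) false + shapley K Rglob i (s i)).
Proof.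
set w := fun i => _.
have objE a : shapley_objective K rew Rglob s a =
    \sum_i rew i (s i) false + \sum_i w i * (a i)%:R.
  rewrite -big_split; apply: eq_bigr => i _ /=.
  by rewrite /w; case: (a i) => /=; ring.
rewrite top_index_actionsE; apply/setP => a; rewrite !inE; congr (_ && _).
by apply: eq_forallb => b; rewrite !objE lerD2l.
Qed.

Theorem theorem7 (R : realType) (S : finType) (N K : nat)
  (rew : 'I_N -> S -> bool -> R) (Rglob : jstate S N -> action N -> R)
  (gamma : R) (tb : jstate S N -> {set action N} -> action N)
  (S_nonempty : (0 < #|S|)%N) (K_le_N : (K <= N)%N)
  (gamma_bound : 0 <= gamma < 1)
  (Rglob_monotone : forall s, monotone_setfun (fun A => Rglob s (pulling A)))
  (Rglob_submodular : forall s, submodular (fun A => Rglob s (pulling A)))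
  (tbP : tie_breaking tb) :
  exists (P : 'I_N -> S -> bool -> S -> R) (s0 : jstate S N) (ALG OPT : R),
    [/\ is_transition P,
        expected_return rew Rglob gamma P s0
          (shapley_whittle K rew Rglob gamma P tb) ALG,
        optimal_return K rew Rglob gamma P s0 OPT &
        ALG <= theta_shapley K rew Rglob tb * OPT].
Proof.
have /andP[_ gamma1] := gamma_bound.
have /card_gt0P[x0 _] := S_nonempty.
pose tot := total_reward rew Rglob.
pose ahat s := tb s (shapley_argmax K rew Rglob s).
have idleK : (norm1 (@idle N) <= K)%N by rewrite norm1_idle.
pose best s := [arg max_(a > idle | (norm1 a <= K)%N) tot s a]%O.
have bestP s : (norm1 (best s) <= K)%N /\
    forall a, (norm1 a <= K)%N -> tot s a <= tot s (best s).
  by rewrite /best; case: arg_maxP.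
have max_rewardE s : max_reward K rew Rglob s = tot s (best s).
  by apply: (@sup_attained _ _ _ (tot s)) => [|a aK]; apply (bestP s).
have ahatK s : (norm1 (ahat s) <= K)%N.
  pose obj := shapley_objective K rew Rglob s.
  suff : ahat s \in shapley_argmax K rew Rglob s by rewrite inE => /andP[].
  (* [tbP] gives membership only for an inhabited set; a maximizer among the finitely many actions
     inhabits it. *)
  case: (@arg_maxP _ _ _ idle (fun a => norm1 a <= K)%N obj idleK) => a aK maxa.
  apply: (tbP s _ a); rewrite inE aK /=.
  by apply/forallP => b; apply/implyP; exact: maxa.
pose ratio s := tot s (ahat s) / tot s (best s).
pose s0 := [arg min_(s < [ffun=> x0] : jstate S N) ratio s]%O.
have s0P s : ratio s0 <= ratio s.
  by rewrite /s0; case: arg_minP => // s1 _; apply.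
have thetaE : theta_shapley K rew Rglob tb = ratio s0.
  rewrite -(@inf_attained _ _ setT ratio s0) //; congr inf; congr image.
  by apply/funext => s; rewrite max_rewardE.
have policyE : shapley_whittle K rew Rglob gamma stay tb s0 = ahat s0.
  rewrite /ahat shapley_argmaxE /shapley_whittle.
  congr (tb _ (top_index_actions _ _)).
  by apply/funext => i; rewrite shapley_whittle_index_stay.
exists stay, s0, (tot s0 (ahat s0) / (1 - gamma)),
  (tot s0 (best s0) / (1 - gamma)).
have pos : 0 <= (1 - gamma)^-1 by rewrite invr_ge0; lra.
split; first exact: is_transition_stay.
- by rewrite -policyE; exact: expected_return_stay.
- split=> [|pi v' piK /expected_return_stay_unique ->//].
    (* Feasibility is required in every state, hence the policy that plays the best action of [s0]
       everywhere. *)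
    exists (fun=> best s0) => [s|]; first by case: (bestP s0).
    exact: expected_return_stay.
  by rewrite ler_wpM2r //; apply (bestP s0).
- rewrite thetaE mulrA ler_wpM2r // /ratio.
  (* A nonzero best reward cancels whatever its sign. If it is 0, the product is 0 and the bound is
     the maximality of [best s0]. *)
  have [best0|best_neq0] := eqVneq (tot s0 (best s0)) 0; last by rewrite divfK.
  by rewrite best0 mulr0 -best0; apply (bestP s0).
Qed.
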